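(* Let $n\ge 2$ and let $0\le \epsilon<1/2$. Let $\mathcal{A}$ be any quantum query (decision tree) algorithm that, for every permutation $\sigma$ of $\{0,1,\dots,n-1\}$, given oracle access to the comparison matrix $M_\sigma$, outputs $\sigma$ with probability at least $1-\epsilon$. Then the number $T$ of comparisons (oracle queries) made by $\mathcal{A}$ satisfies $$T\ \ge\ \frac{1-2\sqrt{\epsilon(1-\epsilon)}}{2\pi}\,\bigl(nH_{n-1}-n+1\bigr),$$ where $H_m=\sum_{i=1}^m 1/i$. In particular, for every constant $\epsilon<1/2$, $T=\Omega(n\log n)$.
   Context: Sorting $n$ numbers by comparisons is modeled as follows. The numbers $x_0,\dots,x_{n-1}$ are given by a permutation $\sigma$ of $\{0,\dots,n-1\}$ via $x_i=\sigma(i)$, and the input is the comparison matrix $M_\sigma\in\{0,1\}^{n\times n}$ with $(M_\sigma)_{i,j}=1$ if $\sigma(i)\le\sigma(j)$ and $0$ otherwise. A quantum query algorithm works in the Hilbert space $H$ spanned by orthonormal basis vectors $|i,j,b,c\rangle$ with $0\le i,j\le n-1$, $b\in\{0,1\}$, $c\in\{0,1\}^w$ for some fixed $w\ge0$. The oracle (comparison) gate for input $\sigma$ is the unitary $O_\sigma|i,j,b,c\rangle=|i,j,b\oplus(M_\sigma)_{i,j},c\rangle$. An algorithm making $T$ queries consists of fixed unitaries $U_0,\dots,U_T$ (independent of $\sigma$) and produces the final state $U_TO_\sigma U_{T-1}O_\sigma\cdots U_1O_\sigma U_0|\vec 0\rangle$; it sorts with error probability at most $\epsilon$ if there is a measurement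 which, applied to this final state, yields $\sigma$ with probability at least $1-\epsilon$ for every input $\sigma$. The number of comparisons is the number $T$ of oracle applications. *)

(* Defs.v *)
(* + mathcomp-real-closed (complex numbers R[i]) + analysis (pi). *)
From mathcomp Require Import all_boot all_algebra all_fingroup complex.
From mathcomp Require Import reals trigo.
Set Implicit Arguments. Unset Strict Implicit. Unset Printing Implicit Defensive.
Import GRing.Theory Num.Theory.
Local Open Scope ring_scope.

(* Basis labels |i,j,b,c> with 0<=i,j<=n-1, b in {0,1}, c in {0,1}^w. *)
Definition basis_label (n w : nat) : finType :=
  ('I_n * 'I_n * bool * (w.-tuple bool))%type.

(* Dimension of the Hilbert space H. *)
Definition hdim (n w : nat) : nat := #|basis_label n w|.

(* Comparison matrix: (M_sigma)_{i,j} = 1 iff sigma(i) <= sigma(j). *)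
Definition cmp_matrix (n : nat) (s : 'S_n) (i j : 'I_n) : bool := (s i <= s j)%N.

(* Oracle action on basis labels. *)
Definition oracle_label (n w : nat) (s : 'S_n) (x : basis_label n w)
  : basis_label n w :=
  let: (i, j, b, c) := x in (i, j, b (+) cmp_matrix s i j, c).

(* Oracle unitary O_sigma as a matrix in the basis enumerated by enum_val. *)
Definition oracle (R : rcfType) (n w : nat) (s : 'S_n) : 'M[R[i]]_(hdim n w) :=
  \matrix_(r, k) (enum_rank (oracle_label s (enum_val k)) == r)%:R.

(* The initial state |0> = |0,0,0,0^w>. *)
Definition zero_state (R : rcfType) (n w : nat) : 'cV[R[i]]_(hdim n w) :=
  \col_k (let: (i, j, b, c) := enum_val k in
          [&& val i == 0%N, val j == 0%N, ~~ b & val c == nseq w false])%:R.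

(* Conjugate transpose. *)
Definition adjoint (R : rcfType) (m p : nat) (A : 'M[R[i]]_(m, p)) : 'M[R[i]]_(p, m) :=
  (map_mx (fun z : R[i] => z^*) A)^T.

Definition unitary (R : rcfType) (d : nat) (U : 'M[R[i]]_d) : Prop :=
  U *m adjoint U = 1%:M /\ adjoint U *m U = 1%:M.

(* State after k+1 unitaries and k queries:
   run U s 0 = U_0 |0>,  run U s (k+1) = U_{k+1} O_s (run U s k).
   The final state of a T-query algorithm is run U s T. *)
Fixpoint run (R : rcfType) (n w : nat) (U : nat -> 'M[R[i]]_(hdim n w))
  (s : 'S_n) (k : nat) : 'cV[R[i]]_(hdim n w) :=
  match k with
  | 0 => U 0%N *m zero_state R n w
  | k'.+1 => U k *m (oracle R w s *m run U s k')
  end.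

(* Squared Euclidean norm of a column vector, as a real number. *)
Definition sqnorm (R : rcfType) (d : nat) (v : 'cV[R[i]]_d) : R :=
  \sum_(k < d) ((complex.Re (v k 0)) ^+ 2 + (complex.Im (v k 0)) ^+ 2).

(* A general quantum measurement with outcomes in 'S_n on H:
   measurement operators E_sigma with sum_sigma E_sigma^dagger E_sigma = I;
   outcome sigma has probability ||E_sigma psi||^2. *)
Definition measurement (R : rcfType) (n d : nat) (E : 'S_n -> 'M[R[i]]_d) : Prop :=
  \sum_(s : 'S_n) adjoint (E s) *m E s = 1%:M.

Definition meas_prob (R : rcfType) (n d : nat) (E : 'S_n -> 'M[R[i]]_d)
  (s : 'S_n) (psi : 'cV[R[i]]_d) : R := sqnorm (E s *m psi).

(* A T-query algorithm (U_0..U_T unitaries) sorts with error at most eps. *)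
Definition sorts_with_error (R : rcfType) (n w T : nat)
  (U : nat -> 'M[R[i]]_(hdim n w)) (eps : R) : Prop :=
  (forall k, (k <= T)%N -> unitary (U k)) /\
  exists E : 'S_n -> 'M[R[i]]_(hdim n w),
    measurement E /\ forall s : 'S_n, 1 - eps <= meas_prob E s (run U s T).

(* Harmonic number H_m = sum_{i=1}^m 1/i. *)
Definition harmonic (R : numFieldType) (m : nat) : R :=
  \sum_(1 <= k < m.+1) (k%:R)^-1.

(* Main.v *)
Require Import Defs.
From mathcomp Require Import all_boot all_order all_algebra all_fingroup complex.
From mathcomp Require Import reals topology normedtype derive trigo.
From mathcomp Require Import zify ring lra.
Set Implicit Arguments. Unset Strict Implicit. Unset Printing Implicit Defensive.
Import Order.TTheory GRing.Theory Num.Theory numFieldNormedType.Exports.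
Local Open Scope ring_scope.

(** The weighted adversary argument of Hoyer, Neerbek and Shi. For k < e let
    cyc k e be the cycle k -> k+1 -> ... -> e -> k, and give the pair of inputs
    (s, cyc k e o s) the weight 1 / (e - k). The weighted sum of the inner
    products of the states on the two inputs is n! (n H_(n-1) - n + 1) before the
    first query, and at most 2 sqrt(eps (1 - eps)) times that after the last one.
    A query changes an inner product only on the comparisons that tell the two
    inputs apart. Let B a b be the l2-norm, over all inputs, of the amplitude on
    comparing the elements of ranks a and b. By Cauchy-Schwarz one query loses at
    most 2 sum_(k <= r < e) B r e * B k (r+1) / (e - k), which for every r is a
    Hilbert form, so Hilbert's inequality bounds the loss by 2 pi n!. *)

(** * Hilbert's inequality *)

Lemma sum_sq_CauchySchwarz (R : rcfType) (I : finType) (P : pred I) (a b : I -> R) :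
  \sum_(i | P i) a i * b i <=
  Num.sqrt (\sum_(i | P i) a i ^+ 2) * Num.sqrt (\sum_(i | P i) b i ^+ 2).
Proof.
set A := \sum_(i | P i) a i ^+ 2; set B := \sum_(i | P i) b i ^+ 2.
set C := \sum_(i | P i) a i * b i.
have A0 : 0 <= A by apply: sumr_ge0 => i _; exact: sqr_ge0.
have B0 : 0 <= B by apply: sumr_ge0 => i _; exact: sqr_ge0.
rewrite -sqrtrM //; apply: (le_trans (ler_norm C)).
rewrite -sqrtr_sqr ler_wsqrtr //.
(* The discriminant argument: this sum of squares is [A * (A * B - C ^+ 2)], and [A] cancels unless
   it is 0, in which case every [a i] vanishes. *)
have : 0 <= \sum_(i | P i) (A * b i - C * a i) ^+ 2.
  by apply: sumr_ge0 => i _; exact: sqr_ge0.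
have -> : \sum_(i | P i) (A * b i - C * a i) ^+ 2 = A * (A * B - C ^+ 2).
  have expand s t : \sum_(i | P i) (s * b i - t * a i) ^+ 2 =
      s ^+ 2 * B - 2 * s * t * C + t ^+ 2 * A.
    rewrite /A /B /C !mulr_sumr -sumrB -big_split /=.
    by apply: eq_bigr => i _; ring.
  by rewrite expand; ring.
have [A_eq0|An0] := eqVneq A 0; last first.
  by rewrite pmulr_rge0 ?subr_ge0 // lt_def An0.
move=> _; suff -> : C = 0 by rewrite A_eq0 mul0r expr0n.
rewrite /C big1 // => i Pi.
have /eqP := A_eq0; rewrite psumr_eq0; last by move=> j _; exact: sqr_ge0.
by move=> /allP/(_ i (mem_index_enum i)); rewrite Pi sqrf_eq0 => /eqP ->; rewrite mul0r.
Qed.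

(** * Trigonometric sums at equally spaced nodes *)

Lemma sin_le_id (R : realType) (x : R) : 0 <= x -> sin x <= x.
Proof.
move=> x0.
have [|c _] := @MVT_segment R sin cos 0 x x0 (fun y _ => is_derive_sin y).
  by apply: continuous_subspaceT; exact: continuous_sin.
rewrite sin0 !subr0 => ->.
by rewrite ler_piMl // cos_le1.
Qed.

Lemma sinDn2pi (R : realType) (x : R) n : sin (x + pi *+ (2 * n)) = sin x.
Proof. by rewrite mulrnA (periodicn (@sinD2pi R)). Qed.

Lemma cosDn2pi (R : realType) (x : R) n : cos (x + pi *+ (2 * n)) = cos x.
Proof. by rewrite mulrnA (periodicn (@cosD2pi R)). Qed.

(* The midpoints of the subdivision of [0, 2 pi] into N equal arcs. *)
Definition node (R : realType) (N t : nat) : R := (2 * t%:R + 1) * pi / N%:R.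

Section Nodes.
Variables (R : realType) (N : nat).
Local Notation node := (node R N).

Lemma sin_arc_gt0 (k : nat) : (0 < k < N)%N -> 0 < sin (k%:R * pi / N%:R : R).
Proof.
move=> /andP[k0 kN]; have N0 : (0 : R) < N%:R by rewrite ltr0n; lia.
apply: sin_gt0_pi; apply/andP; split.
  by rewrite divr_gt0 ?mulr_gt0 ?pi_gt0 ?ltr0n //; lia.
by rewrite ltr_pdivrMr // mulrC ltr_pM2l ?pi_gt0 ?ltr_nat.
Qed.

(** As [k%:R * node t] is an odd multiple of [b = k pi / N], multiplying by [sin b], which is
    nonzero, makes the sum telescope; its two ends differ by [k] full turns. *)
Lemma sum_cos_node (k : nat) : (0 < k < N)%N -> \sum_(t < N) cos (k%:R * node t) = 0.
Proof.
move=> kN; have s0 := sin_arc_gt0 kN.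
have N0 : (N%:R : R) != 0 by rewrite pnatr_eq0; lia.
apply: (mulfI (lt0r_neq0 s0)); rewrite mulr0 mulr_sumr.
set b : R := k%:R * pi / N%:R in s0 *.
transitivity (\sum_(0 <= t < N) (sin (2 * t.+1%:R * b) / 2 - sin (2 * t%:R * b) / 2)).
  rewrite big_mkord; apply: eq_bigr => t _.
  have -> : 2 * t.+1%:R * b = k%:R * node t + b by rewrite /node /b -natr1; ring.
  have -> : 2 * t%:R * b = k%:R * node t - b by rewrite /node /b; ring.
  by rewrite sinB sinD; field.
rewrite (telescope_sumr (fun t => sin (2 * t%:R * b) / 2)) //.
have -> : 2 * N%:R * b = 0 + pi *+ (2 * k) by rewrite /b -[pi *+ _]mulr_natr natrM; field.
by rewrite sinDn2pi mulr0 mul0r sin0 mul0r subr0.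
Qed.

Lemma sum_sin_node (k : nat) : (0 < k < N)%N -> \sum_(t < N) sin (k%:R * node t) = 0.
Proof.
move=> kN; have s0 := sin_arc_gt0 kN.
have N0 : (N%:R : R) != 0 by rewrite pnatr_eq0; lia.
apply: (mulfI (lt0r_neq0 s0)); rewrite mulr0 mulr_sumr.
set b : R := k%:R * pi / N%:R in s0 *.
transitivity (\sum_(0 <= t < N) (- cos (2 * t.+1%:R * b) / 2 - - cos (2 * t%:R * b) / 2)).
  rewrite big_mkord; apply: eq_bigr => t _.
  have -> : 2 * t.+1%:R * b = k%:R * node t + b by rewrite /node /b -natr1; ring.
  have -> : 2 * t%:R * b = k%:R * node t - b by rewrite /node /b; ring.
  by rewrite cosB cosD; field.
rewrite (telescope_sumr (fun t => - cos (2 * t%:R * b) / 2)) //.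
have -> : 2 * N%:R * b = 0 + pi *+ (2 * k) by rewrite /b -[pi *+ _]mulr_natr natrM; field.
by rewrite cosDn2pi mulr0 mul0r cos0 subrr.
Qed.

(* The sawtooth is bounded by 1: this is where the constant pi of Hilbert's
   inequality comes from. *)
Lemma sum_sawtooth_sin_node (k : nat) : (0 < k < N)%N ->
  \sum_(t < N) (1 - (2 * t%:R + 1) / N%:R) * sin (k%:R * node t)
  = (sin (k%:R * pi / N%:R))^-1.
Proof.
move=> kN; have s0 := sin_arc_gt0 kN.
have N0 : (N%:R : R) != 0 by rewrite pnatr_eq0; lia.
transitivity (- N%:R^-1 * \sum_(t < N) (2 * t%:R + 1) * sin (k%:R * node t)).
  transitivity (\sum_(t < N) sin (k%:R * node t) -
     N%:R^-1 * \sum_(t < N) (2 * t%:R + 1) * sin (k%:R * node t)).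
    rewrite mulr_sumr -sumrB; apply: eq_bigr => t _; ring.
  by rewrite sum_sin_node // add0r mulNr.
set b : R := k%:R * pi / N%:R in s0 *.
apply: (mulfI (lt0r_neq0 s0)); rewrite mulfV ?lt0r_neq0 // mulrCA mulr_sumr.
suff -> : \sum_(t < N) sin b * ((2 * t%:R + 1) * sin (k%:R * node t)) = - N%:R.
  by rewrite mulrNN mulVf.
transitivity (\sum_(t < N) sin b * (2 * sin b)^-1 *
    ((2 * t%:R + 1) * (cos (2 * t%:R * b) - cos (2 * t.+1%:R * b)))).
  apply: eq_bigr => t _.
  have -> : 2 * t.+1%:R * b = k%:R * node t + b by rewrite /node /b -natr1; ring.
  have -> : 2 * t%:R * b = k%:R * node t - b by rewrite /node /b; ring.
  rewrite cosB cosD; field; exact: lt0r_neq0.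
(* Summation by parts: the cosine sum vanishes and the telescoping part contributes [- N]. *)
transitivity (\sum_(t < N) (cos (k%:R * node t) * cos b -
    ((t.+1%:R * cos (2 * t.+1%:R * b)) - (t%:R * cos (2 * t%:R * b))))).
  apply: eq_bigr => t _.
  have -> : 2 * t.+1%:R * b = k%:R * node t + b by rewrite /node /b -natr1; ring.
  have -> : 2 * t%:R * b = k%:R * node t - b by rewrite /node /b; ring.
  rewrite cosB cosD -natr1; field; exact: lt0r_neq0.
rewrite sumrB -mulr_suml sum_cos_node // mul0r.
rewrite -(big_mkord xpredT (fun t => t.+1%:R * cos (2 * t.+1%:R * b) - t%:R * cos (2 * t%:R * b))).
rewrite (telescope_sumr (fun t => t%:R * cos (2 * t%:R * b))) //.
have -> : 2 * N%:R * b = 0 + pi *+ (2 * k) by rewrite /b -[pi *+ _]mulr_natr natrM; field.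
by rewrite cosDn2pi cos0 mul0r subr0 mulr1 sub0r.
Qed.

(** For [b = k pi / N] the sum is [1 / sin b], and [sin b <= b] gives
    [1 / k = (pi / N) / b <= (pi / N) / sin b]. *)
Lemma inv_le_sawtooth (k : nat) : (0 < k < N)%N ->
  (k%:R)^-1 <= pi / N%:R *
    \sum_(t < N) (1 - (2 * t%:R + 1) / N%:R) * sin (k%:R * node t).
Proof.
move=> kN; rewrite sum_sawtooth_sin_node //; have s0 := sin_arc_gt0 kN.
have N0 : (0 : R) < N%:R by rewrite ltr0n; lia.
have k0 : (0 : R) < k%:R by rewrite ltr0n; lia.
rewrite ler_pdivlMr // mulrC ler_pdivrMr //.
have -> : pi / N%:R * k%:R = k%:R * pi / N%:R :> R by ring.
by apply: sin_le_id; rewrite divr_ge0 ?mulr_ge0 ?pi_ge0 // ltW.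
Qed.

Lemma sum_cos_node_sub (i j : 'I_N) :
  \sum_(t < N) cos ((i%:R - j%:R) * node t) = (i == j)%:R * N%:R.
Proof.
have [->|ij] := eqVneq i j.
  under eq_bigr do rewrite subrr mul0r cos0.
  by rewrite sumr_const card_ord mul1r.
rewrite mul0r; have {}ij : (i != j :> nat) by [].
have [h|h] := leqP i j.
  under eq_bigr => t _.
    have -> : (i%:R - j%:R) * node t = - ((j - i)%:R * node t) by rewrite natrB //; ring.
    rewrite cosN; over.
  by apply: sum_cos_node; move: (ltn_ord j) => /=; lia.
under eq_bigr do rewrite -natrB ?(ltnW h) //.
by apply: sum_cos_node; move: (ltn_ord i) => /=; lia.
Qed.

(** On expanding the squares, sine and cosine products combine into [cos ((i - j) theta)], and
    orthogonality over the nodes keeps only the diagonal. *)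
Lemma parseval_node (P : pred 'I_N) (x : 'I_N -> R) :
  \sum_(t < N) ((\sum_(i | P i) x i * sin (i%:R * node t)) ^+ 2
              + (\sum_(i | P i) x i * cos (i%:R * node t)) ^+ 2)
  = N%:R * \sum_(i | P i) x i ^+ 2.
Proof.
transitivity (\sum_(t < N) \sum_(i | P i) \sum_(j | P j)
    x i * x j * cos ((i%:R - j%:R) * node t)).
  apply: eq_bigr => t _; rewrite !expr2 !big_distrlr /= -big_split /=.
  apply: eq_bigr => i _; rewrite -big_split; apply: eq_bigr => j _ /=.
  by rewrite mulrBl cosB; ring.
rewrite exchange_big mulr_sumr; apply: eq_bigr => i Pi /=.
rewrite exchange_big /= (bigD1 i) //= [X in _ + X]big1 ?addr0.
  by rewrite -mulr_sumr sum_cos_node_sub eqxx mul1r; ring.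
by move=> j /andP[_ ji]; rewrite -mulr_sumr sum_cos_node_sub eq_sym (negbTE ji) mul0r mulr0.
Qed.

(* Since sin x <= x, 1 / (j - i) is at most pi / N times a sawtooth transform of
   sin ((j - i) theta), and the addition formula separates i from j. *)
Lemma hilbert_inequality (P Q : pred 'I_N) (x y : 'I_N -> R) :
  (forall i, 0 <= x i) -> (forall i, 0 <= y i) ->
  (forall i j, P i -> Q j -> (i < j)%N) ->
  \sum_(i | P i) \sum_(j | Q j) x i * y j / (j - i)%:R
  <= pi / 2 * (\sum_(i | P i) x i ^+ 2 + \sum_(j | Q j) y j ^+ 2).
Proof.
move=> x0 y0 PQ; pose phi t : R := 1 - (2 * t%:R + 1) / N%:R.
pose Sx t := \sum_(i | P i) x i * sin (i%:R * node t).
pose Cx t := \sum_(i | P i) x i * cos (i%:R * node t).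
pose Sy t := \sum_(i | Q i) y i * sin (i%:R * node t).
pose Cy t := \sum_(i | Q i) y i * cos (i%:R * node t).
apply: (@le_trans _ _ (\sum_(i | P i) \sum_(j | Q j) \sum_(t < N)
    pi / N%:R * (phi t * ((x i * cos (i%:R * node t)) * (y j * sin (j%:R * node t)) -
              (x i * sin (i%:R * node t)) * (y j * cos (j%:R * node t)))))).
  apply: ler_sum => i Pi; apply: ler_sum => j Qj; have ij := PQ _ _ Pi Qj.
  have /inv_le_sawtooth : (0 < j - i < N)%N by move: (ltn_ord j); lia.
  move=> /(ler_wpM2l (mulr_ge0 (x0 i) (y0 j))) /le_trans; apply.
  rewrite !mulr_sumr; apply: ler_sum => t _.
  by rewrite natrB 1?ltnW // [_ * node t]mulrBl sinB /phi le_eqVlt; apply/orP; left; apply/eqP; ring.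
rewrite (eq_bigr _ (fun i _ => exchange_big _ _ _ _ _ _)) /= exchange_big /=.
apply: (@le_trans _ _ (\sum_(t < N) pi / N%:R *
    (phi t * (Cx t * Sy t - Sx t * Cy t)))).
  apply: ler_sum => t _; rewrite le_eqVlt; apply/orP; left; apply/eqP.
  rewrite /Cx /Sy /Sx /Cy !big_distrlr /= -sumrB !mulr_sumr; apply: eq_bigr => i _.
  by rewrite -sumrB !mulr_sumr.
have [N0|N0] := posnP N.
  rewrite big1; last by move=> [t tN]; exfalso; lia.
  rewrite mulr_ge0 ?divr_ge0 ?pi_ge0 ?addr_ge0 ?sumr_ge0 // => i _; exact: sqr_ge0.
have Np : (0 : R) < N%:R by rewrite ltr0n.
(* Pointwise, [|phi t| <= 1] removes the sawtooth and the arithmetic-geometric mean inequality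
   separates [x] from [y]; Parseval then turns [pi / N * 1/2] into [pi / 2]. *)
apply: (@le_trans _ _ (\sum_(t < N) pi / N%:R *
    (2^-1 * ((Sx t ^+ 2 + Cx t ^+ 2) + (Sy t ^+ 2 + Cy t ^+ 2))))).
  apply: ler_sum => t _; apply: ler_wpM2l; first by rewrite divr_ge0 ?pi_ge0 // ltW.
  have pt : `|phi t| <= 1.
    have tN : (t%:R + 1 : R) <= N%:R by rewrite natr1 ler_nat.
    have q0 : 0 <= (2 * t%:R + 1) / N%:R :> R by rewrite divr_ge0 ?addr_ge0 ?mulr_ge0 // ltW.
    have q1 : (2 * t%:R + 1) / N%:R <= 2 :> R.
      rewrite ler_pdivrMr //. lra.
    by rewrite ler_norml /phi; lra.
  apply: (le_trans (ler_norm _)); rewrite normrM.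
  apply: (le_trans (ler_wpM2r (normr_ge0 _) pt)); rewrite mul1r.
  have young (a b c d : R) : `|b * c - a * d| <= 2^-1 * ((a ^+ 2 + b ^+ 2) + (c ^+ 2 + d ^+ 2)).
    have [h1 h2] := (sqr_ge0 (b - c), sqr_ge0 (b + c)).
    have [h3 h4] := (sqr_ge0 (a - d), sqr_ge0 (a + d)).
    rewrite ler_norml; apply/andP; split; lra.
  exact: young.
rewrite -mulr_sumr -mulr_sumr big_split /= !parseval_node.
by rewrite le_eqVlt; apply/orP; left; apply/eqP; field; rewrite lt0r_neq0.
Qed.
End Nodes.

(** * Inner products and measurements *)

(** The real part of the conjugate of [z] times [w]. Keeping only real parts of inner products
    leaves the argument in the ordered field [R]. *)
Definition cdot (R : rcfType) (z w : R[i]) : R :=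
  complex.Re z * complex.Re w + complex.Im z * complex.Im w.

Definition reip (R : rcfType) (d : nat) (u v : 'cV[R[i]]_d) : R :=
  \sum_(k < d) cdot (u k 0) (v k 0).

Section RealInnerProduct.
Variables (R : rcfType) (d : nat).
Implicit Types (u v : 'cV[R[i]]_d).

Lemma reip_adjoint u v : reip u v = complex.Re ((adjoint u *m v) 0 0).
Proof.
rewrite mxE raddf_sum; apply: eq_bigr => k _.
by rewrite !mxE /cdot; case: (u k 0) => a b; case: (v k 0) => c e /=; rewrite mulNr opprK.
Qed.

Lemma reip_sqnorm u : reip u u = sqnorm u.
Proof. by apply: eq_bigr => k _; rewrite /cdot !expr2. Qed.

Lemma adjointM m p q (A : 'M[R[i]]_(m, p)) (B : 'M[R[i]]_(p, q)) :
  adjoint (A *m B) = adjoint B *m adjoint A.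
Proof. by rewrite /adjoint map_mxM trmx_mul. Qed.

Lemma reip_unitary (A : 'M[R[i]]_d) u v : unitary A -> reip (A *m u) (A *m v) = reip u v.
Proof.
move=> [_ AA]; rewrite !reip_adjoint adjointM.
by rewrite -mulmxA (mulmxA (adjoint A)) AA mul1mx.
Qed.

Lemma sqnorm_unitary (A : 'M[R[i]]_d) u : unitary A -> sqnorm (A *m u) = sqnorm u.
Proof. by move=> UA; rewrite -!reip_sqnorm reip_unitary. Qed.

Lemma sqnorm_ge0 u : 0 <= sqnorm u.
Proof. by apply: sumr_ge0 => k _; rewrite addr_ge0 ?sqr_ge0. Qed.

Definition cabs (z : R[i]) : R := Num.sqrt (complex.Re z ^+ 2 + complex.Im z ^+ 2).

Lemma sqr_cabs z : cabs z ^+ 2 = complex.Re z ^+ 2 + complex.Im z ^+ 2.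
Proof. by rewrite sqr_sqrtr // addr_ge0 ?sqr_ge0. Qed.

Lemma cabs_ge0 z : 0 <= cabs z. Proof. exact: sqrtr_ge0. Qed.

Lemma normr_cdot_le (z w : R[i]) :
  `|cdot z w| <= cabs z * cabs w.
Proof.
rewrite -sqrtrM ?addr_ge0 ?sqr_ge0 // -sqrtr_sqr ler_wsqrtr //.
rewrite /cdot; set a := complex.Re z; set b := complex.Im z; set c := complex.Re w; set e := complex.Im w.
(* Lagrange's identity: the two sides differ by exactly this square. *)
have := sqr_ge0 (a * e - b * c); nra.
Qed.

Lemma reip_le u v : reip u v <= Num.sqrt (sqnorm u) * Num.sqrt (sqnorm v).
Proof.
apply: (@le_trans _ _ (\sum_k cabs (u k 0) * cabs (v k 0))).
  by apply: ler_sum => k _; apply: le_trans (ler_norm _) (normr_cdot_le _ _).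
apply: le_trans (sum_sq_CauchySchwarz _ _ _) _.
by rewrite !(eq_bigr _ (fun k _ => sqr_cabs _)).
Qed.

End RealInnerProduct.

(** The determinant [a * b' - a' * b] is at least [(1 - e) - e], and for unit vectors the squares of
    determinant and dot product add up to 1; finally [1 - (1 - 2 e)^2 = 4 e (1 - e)]. *)
Lemma cross_unit_vectors_le (R : rcfType) (e a a' b b' : R) :
  0 <= e -> e < 2^-1 -> 0 <= a -> 0 <= a' -> 0 <= b -> 0 <= b' ->
  a ^+ 2 + a' ^+ 2 = 1 -> b ^+ 2 + b' ^+ 2 = 1 -> 1 - e <= a ^+ 2 -> 1 - e <= b' ^+ 2 ->
  a * b + a' * b' <= 2 * Num.sqrt (e * (1 - e)).
Proof.
move=> e0 e1 a0 a'0 b0 b'0 ha hb hae hbe.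
have e2 : 0 <= e * (1 - e) by nra.
rewrite -[leLHS]ger0_norm ?addr_ge0 ?mulr_ge0 // -sqrtr_sqr.
have -> : 2 * Num.sqrt (e * (1 - e)) = Num.sqrt (4 * (e * (1 - e))).
  have -> : (4 : R) = 2 ^+ 2 by ring.
  by rewrite [in RHS]sqrtrM ?sqr_ge0 // sqrtr_sqr ger0_norm.
apply: ler_wsqrtr.
have lagrange : (a * b + a' * b') ^+ 2 + (a * b' - a' * b) ^+ 2
              = (a ^+ 2 + a' ^+ 2) * (b ^+ 2 + b' ^+ 2) by ring.
have p1 : 1 - e <= a * b'.
  have : (1 - e) ^+ 2 <= (a * b') ^+ 2 by rewrite exprMn expr2 ler_pM //; lra.
  by rewrite ler_sqr ?nnegrE ?mulr_ge0 //; lra.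
have p2 : a' * b <= e.
  have : (a' * b) ^+ 2 <= e ^+ 2.
    by rewrite exprMn [leRHS]expr2 ler_pM ?sqr_ge0 //; lra.
  by rewrite ler_sqr ?nnegrE ?mulr_ge0 //.
have : (1 - 2 * e) ^+ 2 <= (a * b' - a' * b) ^+ 2.
  by rewrite ler_sqr ?nnegrE; lra.
move: lagrange; rewrite ha hb => lagrange; nra.
Qed.

Section Measurement.
Variables (R : rcfType) (n d : nat) (E : 'S_n -> 'M[R[i]]_d).
Hypothesis mE : measurement E.

Lemma sum_reip_measurement (u v : 'cV[R[i]]_d) : \sum_s reip (E s *m u) (E s *m v) = reip u v.
Proof.
rewrite reip_adjoint -[v in RHS]mul1mx -mE mulmx_suml mulmx_sumr summxE raddf_sum.
by apply: eq_bigr => s _; rewrite reip_adjoint adjointM -!mulmxA.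
Qed.

Lemma sum_meas_prob (u : 'cV[R[i]]_d) : \sum_s meas_prob E s u = sqnorm u.
Proof. by rewrite -reip_sqnorm -sum_reip_measurement; apply: eq_bigr => s _; rewrite reip_sqnorm. Qed.

(** Merging all outcomes other than [s] makes the measurement binary; Cauchy-Schwarz reduces the
    claim to two unit vectors in a quadrant, each near a different axis. *)
Lemma distinguishable_reip_le (e : R) (s t : 'S_n) (u v : 'cV[R[i]]_d) :
  0 <= e -> e < 2^-1 -> s != t -> sqnorm u = 1 -> sqnorm v = 1 ->
  1 - e <= meas_prob E s u -> 1 - e <= meas_prob E t v ->
  reip u v <= 2 * Num.sqrt (e * (1 - e)).
Proof.
move=> e0 e1 st u1 v1 us vt.
have split_prob w : sqnorm w = 1 -> meas_prob E s w + \sum_(r | r != s) meas_prob E r w = 1.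
  by move=> w1; rewrite -w1 -sum_meas_prob [RHS](bigD1 s).
have p0 r w : 0 <= meas_prob E r w by exact: sqnorm_ge0.
have s0 w : 0 <= \sum_(r | r != s) meas_prob E r w by apply: sumr_ge0.
rewrite -sum_reip_measurement (bigD1 s) //=.
apply: (@le_trans _ _ (Num.sqrt (meas_prob E s u) * Num.sqrt (meas_prob E s v) +
   Num.sqrt (\sum_(r | r != s) meas_prob E r u) * Num.sqrt (\sum_(r | r != s) meas_prob E r v))).
  apply: lerD; first exact: reip_le.
  apply: (@le_trans _ _ (\sum_(r | r != s) Num.sqrt (meas_prob E r u) * Num.sqrt (meas_prob E r v))).
    by apply: ler_sum => r _; exact: reip_le.
  apply: le_trans (sum_sq_CauchySchwarz _ _ _) _.
  by rewrite !(eq_bigr _ (fun r _ => sqr_sqrtr (p0 r _))).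
apply: cross_unit_vectors_le; rewrite ?sqrtr_ge0 ?sqr_sqrtr ?split_prob //.
(* The outcome [t] is one of the merged ones, so they carry at least [1 - e] of [v]. *)
apply: (le_trans vt); rewrite (bigD1 t) ?(eq_sym t) //= lerDl.
by apply: sumr_ge0.
Qed.
End Measurement.

(** * Oracle queries *)

Section Oracle.
Variables (R : rcfType) (n w : nat).
Local Notation label := (basis_label n w).
Local Notation state := ('cV[R[i]]_(hdim n w)).
Implicit Types (u v : state) (s t : 'S_n) (x : label).

Definition amp u x : R[i] := u (enum_rank x) 0.

Lemma reip_amp u v : reip u v = \sum_x cdot (amp u x) (amp v x).
Proof. by rewrite /reip (reindex (@enum_rank label)) //; exact/onW_bij/enum_rank_bij. Qed.

Lemma sqnorm_amp u : sqnorm u = \sum_x cabs (amp u x) ^+ 2.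
Proof.
rewrite -reip_sqnorm reip_amp; apply: eq_bigr => x _.
by rewrite sqr_cabs /cdot !expr2.
Qed.

Lemma oracle_labelK s : involutive (@oracle_label n w s).
Proof. by case=> [[[i j] b] c] /=; rewrite -addbA addbb addbF. Qed.

Lemma amp_oracle s u x : amp (oracle R w s *m u) x = amp u (oracle_label s x).
Proof.
rewrite /amp mxE (bigD1 (enum_rank (oracle_label s x))) //= big1 ?addr0.
  by rewrite !mxE enum_rankK oracle_labelK eqxx mul1r.
move=> k kx; rewrite !mxE (inj_eq enum_rank_inj) (_ : (_ == x) = false) ?mul0r //.
apply: contraNF kx => /eqP <-; by rewrite oracle_labelK enum_valK.
Qed.

(** Substituting [oracle_label s] for the summation variable moves both queries onto [v], where only
    their composite matters. *)
Lemma reip_oracle s t u v :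
  reip (oracle R w s *m u) (oracle R w t *m v)
  = \sum_x cdot (amp u x) (amp v (oracle_label t (oracle_label s x))).
Proof.
rewrite reip_amp (reindex_inj (inv_inj (oracle_labelK s))).
by apply: eq_bigr => x _; rewrite !amp_oracle oracle_labelK.
Qed.

Lemma sqnorm_oracle s u : sqnorm (oracle R w s *m u) = sqnorm u.
Proof.
rewrite -!reip_sqnorm reip_oracle reip_amp.
by apply: eq_bigr => x _; rewrite oracle_labelK.
Qed.

Definition flip x : label := let: (i, j, b, c) := x in (i, j, ~~ b, c).

Lemma flipK : involutive flip.
Proof. by case=> [[[i j] b] c] /=; rewrite negbK. Qed.

Definition distinguishes s t x : bool :=
  let: (i, j, _, _) := x in cmp_matrix s i j != cmp_matrix t i j.

Lemma oracle_label_comp s t x :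
  oracle_label t (oracle_label s x) = if distinguishes s t x then flip x else x.
Proof.
by case: x => [[[i j] b] c] /=; case: (cmp_matrix s i j); case: (cmp_matrix t i j); case: b.
Qed.

(* x queries the two elements whose ranks under s are a and b. *)
Definition queries s (a b : nat) x : bool :=
  let: (i, j, _, _) := x in
  ((s i == a :> nat) && (s j == b :> nat)) || ((s i == b :> nat) && (s j == a :> nat)).

(** Ranks are natural numbers because [r.+1] will be allowed to reach [n], where no label qualifies
    and the mass is 0. *)
Definition query_mass s (a b : nat) u : R := \sum_(x | queries s a b x) cabs (amp u x) ^+ 2.

Lemma query_mass_ge0 s a b u : 0 <= query_mass s a b u.
Proof. by apply: sumr_ge0 => x _; exact: sqr_ge0. Qed.

(** A label determines the unordered pair of ranks it compares, so with [a p < b p] it is counted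
    for at most one [p]. *)
Lemma sum_query_mass_le (I : finType) (P : pred I) (a b : I -> nat) s u :
  (forall p, P p -> (a p < b p)%N) ->
  (forall p q, P p -> P q -> a p = a q -> b p = b q -> p = q) ->
  \sum_(p | P p) query_mass s (a p) (b p) u <= sqnorm u.
Proof.
move=> ab inj; rewrite sqnorm_amp.
under eq_bigr do rewrite /query_mass big_mkcond.
rewrite exchange_big /=; apply: ler_sum => x _.
rewrite -big_mkcondr sumr_const -[leRHS]mulr1n; apply: ler_wpMn2l; first exact: sqr_ge0.
apply/card_le1_eqP => p q /andP[Pp xp] /andP[Pq xq].
have := ab _ Pp; have := ab _ Pq; move: xp xq; case: x => [[[i j] ?] ?] /=.
by move=> *; apply: inj => //; lia.
Qed.

End Oracle.

(** * The cycles relating paired inputs *)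

Section Cycle.
Variables (n : nat) (k e : 'I_n).

(* The cycle k -> k+1 -> ... -> e -> k; the identity when e < k. *)
Definition cyc_nat (a : nat) : nat :=
  if (k <= a < e)%N then a.+1 else if (k <= e)%N && (a == e :> nat) then (k : nat) else a.

Lemma cyc_nat_lt (a : 'I_n) : (cyc_nat a < n)%N.
Proof.
rewrite /cyc_nat; move: (ltn_ord a) (ltn_ord k) (ltn_ord e).
by do ?[case: ifP => ?]; lia.
Qed.

Definition cyc_ord (a : 'I_n) : 'I_n := Ordinal (cyc_nat_lt a).

Lemma cyc_ord_inj : injective cyc_ord.
Proof. by move=> a b /(congr1 val) /= h; apply: ord_inj; move: h; rewrite /cyc_nat; do ?[case: ifP => ?]; lia. Qed.

Definition cyc : 'S_n := perm cyc_ord_inj.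

Lemma cycE (a : 'I_n) : cyc a = cyc_nat a :> nat.
Proof. by rewrite permE. Qed.

Lemma cyc_neq1 : (k < e)%N -> cyc != 1%g.
Proof.
move=> ke; apply/eqP => /permP/(_ e)/(congr1 val) /=.
by rewrite perm1 cycE /cyc_nat; do ?[case: ifP => ?]; lia.
Qed.

Lemma queries_cyc (w : nat) (s : 'S_n) (v : nat) (x : basis_label n w) : (k <= v < e)%N ->
  queries s v e x -> queries (s * cyc) k v.+1 x.
Proof. by case: x => [[[i j] ?] ?] /= kve; rewrite !permM !cycE /cyc_nat; do ?[case: ifP => ?]; lia. Qed.

(** The cycle preserves the order of all ranks except [e], which drops below exactly the ranks in
    [[k, e)]. *)
Lemma distinguishes_cyc (w : nat) (s : 'S_n) (x : basis_label n w) : (k < e)%N ->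
  distinguishes s (s * cyc) x -> exists2 v : 'I_n, (k <= v < e)%N & queries s v e x.
Proof.
case: x => [[[i j] b] c] ke; rewrite /distinguishes /cmp_matrix !permM !cycE => d.
have [se|se] := eqVneq (s i : nat) e.
  exists (s j); last by rewrite /queries se !eqxx orbT.
  by move: d; rewrite /cyc_nat; do ?[case: ifP => ?]; lia.
exists (s i); last first.
  by rewrite /queries eqxx; move: d se; rewrite /cyc_nat; do ?[case: ifP => ?]; lia.
by move: d se; rewrite /cyc_nat; do ?[case: ifP => ?]; lia.
Qed.
End Cycle.

(** * Effect of one query on one pair of inputs *)

Section QueryStep.
Variables (R : rcfType) (n w : nat).
Local Notation label := (basis_label n w).
Local Notation state := ('cV[R[i]]_(hdim n w)).
Local Notation oracle := (oracle R w).

Lemma queries_flip (s : 'S_n) a b (x : label) : queries s a b (flip x) = queries s a b x.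
Proof. by case: x => [[[i j] ?] ?]. Qed.

Lemma cdot_diff_le (z y y' : R[i]) : cdot z y - cdot z y' <= cabs z * (cabs y + cabs y').
Proof.
apply: (le_trans (ler_norm _)); apply: (le_trans (ler_normB _ _)).
by rewrite mulrDr lerD // normr_cdot_le.
Qed.

(* s and s * cyc k e disagree only on comparisons of the element of rank e under
   s with one of rank r, k <= r < e; under s * cyc k e these two elements have
   ranks k and r + 1. *)
Lemma query_step_le (k e : 'I_n) (s : 'S_n) (u v : state) : (k < e)%N ->
  reip u v - reip (oracle s *m u) (oracle (s * cyc k e)%g *m v) <=
  2 * \sum_(r < n | (k <= r < e)%N)
    Num.sqrt (query_mass s r e u) * Num.sqrt (query_mass (s * cyc k e)%g k r.+1 v).
Proof.
move=> ke; set t := (s * cyc k e)%g.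
rewrite reip_oracle reip_amp -sumrB.
pose g x := cabs (amp u x) * (cabs (amp v x) + cabs (amp v (flip x))).
have g0 x : 0 <= g x by rewrite mulr_ge0 ?addr_ge0 ?cabs_ge0.
(* Labels on which the inputs agree cancel; every other label is charged to the rank [r] that it
   compares with [e]. *)
apply: (@le_trans _ _ (\sum_x \sum_(r < n | (k <= r < e)%N && queries s r e x) g x)).
  apply: ler_sum => x _; rewrite oracle_label_comp.
  case: ifPn => [/(distinguishes_cyc ke)[r kre qx]|_]; last by rewrite subrr sumr_ge0.
  rewrite (bigD1 r) ?kre //=.
  by apply: (le_trans (cdot_diff_le _ _ _)); rewrite lerDl sumr_ge0.
rewrite (exchange_big_dep (fun r : 'I_n => (k <= r < e)%N)) /=; last by move=> x r _ /andP[].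
rewrite mulr_sumr; apply: ler_sum => r kre.
rewrite (eq_bigl (queries s r e)); last by move=> x; rewrite kre.
under eq_bigr do rewrite /g mulrDr.
rewrite big_split mulrDl !mul1r.
have mono (f : label -> R) : (forall x, 0 <= f x) ->
    \sum_(x | queries s r e x) f x <= \sum_(x | queries t k r.+1 x) f x.
  move=> f0; rewrite big_mkcond [leRHS]big_mkcond; apply: ler_sum => x _ /=.
  by case: ifP => [/(queries_cyc kre)->//|_]; case: ifP.
(* The amplitudes of [v] at [x] and at [flip x] obey the same bound, since flipping leaves the
   compared elements unchanged; hence the factor 2. *)
apply: lerD; apply: le_trans (sum_sq_CauchySchwarz _ _ _) _.
  rewrite ler_wpM2l ?sqrtr_ge0 ?ler_wsqrtr //.
  by apply: mono => x; exact: sqr_ge0.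
rewrite ler_wpM2l ?sqrtr_ge0 ?ler_wsqrtr //.
apply: (le_trans (mono _ (fun x => sqr_ge0 _))).
rewrite (reindex_inj (inv_inj (@flipK n w))) /query_mass /=.
under eq_bigl do rewrite queries_flip.
by under eq_bigr do rewrite flipK.
Qed.
End QueryStep.

(** * The weighted adversary sum and its loss per query *)

Lemma sum_triples_exchange (V : nmodType) (n : nat) (F : 'I_n -> 'I_n -> 'I_n -> V) :
  \sum_(k < n) \sum_(e < n | (k < e)%N) \sum_(r < n | (k <= r < e)%N) F k e r
  = \sum_(r < n) \sum_(k < n | (k <= r)%N) \sum_(e < n | (r < e)%N) F k e r.
Proof.
transitivity (\sum_(k < n) \sum_(r < n | (k <= r)%N) \sum_(e < n | (r < e)%N) F k e r).
  apply: eq_bigr => k _.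
  rewrite (exchange_big_dep (fun r : 'I_n => (k <= r)%N)) /=; last by move=> e r _ /andP[].
  by apply: eq_bigr => r kr; apply: eq_bigl => e; lia.
by rewrite (exchange_big_dep xpredT).
Qed.

Section Weight.
Variables (R : realType) (n w : nat).
Local Notation state := ('cV[R[i]]_(hdim n w)).

Definition weight (psi : 'S_n -> state) : R :=
  \sum_s \sum_(k < n) \sum_(e < n | (k < e)%N)
    (e - k)%:R^-1 * reip (psi s) (psi (s * cyc k e)%g).

Lemma weight_step_le (psi : 'S_n -> state) : (forall s, sqnorm (psi s) = 1) ->
  weight psi - weight (fun s => oracle R w s *m psi s) <= 2 * pi * #|'S_n|%:R.
Proof.
move=> psi1.
pose B (a b : nat) := Num.sqrt (\sum_s query_mass s a b (psi s)).
have B0 a b : 0 <= \sum_s query_mass s a b (psi s).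
  by apply: sumr_ge0 => s _; exact: query_mass_ge0.
pose h (s : 'S_n) (k e r : 'I_n) := Num.sqrt (query_mass s r e (psi s)) *
  Num.sqrt (query_mass (s * cyc k e)%g k r.+1 (psi (s * cyc k e)%g)).
have hB k e r : \sum_s h s k e r <= B r e * B k r.+1.
  apply: le_trans (sum_sq_CauchySchwarz _ _ _) _.
  under eq_bigr do rewrite sqr_sqrtr ?query_mass_ge0 //.
  under [X in _ * Num.sqrt X]eq_bigr do rewrite sqr_sqrtr ?query_mass_ge0 //.
  (* Right multiplication by the cycle permutes the inputs, so the second factor no longer depends
     on the pairing. *)
  by rewrite /B [X in _ <= _ * Num.sqrt X](reindex_inj (mulIg (cyc k e))).
apply: (@le_trans _ _ (\sum_(k < n) \sum_(e < n | (k < e)%N) \sum_(r < n | (k <= r < e)%N)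
    2 * (B k r.+1 * B r e / (e - k)%:R))).
  rewrite /weight -sumrB.
  apply: (@le_trans _ _ (\sum_s \sum_(k < n) \sum_(e < n | (k < e)%N) (e - k)%:R^-1 *
      (2 * \sum_(r < n | (k <= r < e)%N) h s k e r))).
    apply: ler_sum => s _; rewrite -sumrB; apply: ler_sum => k _.
    rewrite -sumrB; apply: ler_sum => e ke; rewrite -mulrBr.
    by apply: ler_wpM2l; [rewrite invr_ge0 | exact: query_step_le].
  rewrite exchange_big; apply: ler_sum => k _; rewrite exchange_big; apply: ler_sum => e _ /=.
  rewrite -!mulr_sumr exchange_big !mulr_sumr; apply: ler_sum => r _.
  rewrite mulrCA ler_pM2l // mulrC ler_wpM2r ?invr_ge0 // [leRHS]mulrC.
  exact: hB.
(* With [r] outermost, [k <= r] and [r < e] are independent conditions, the bipartite shape that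
   Hilbert's inequality requires. *)
rewrite sum_triples_exchange.
apply: (@le_trans _ _ (\sum_(r < n) 2 * (pi / 2 *
    (\sum_(k < n | (k <= r)%N) B k r.+1 ^+ 2 + \sum_(e < n | (r < e)%N) B r e ^+ 2)))).
  apply: ler_sum => r _.
  have := @hilbert_inequality R n (fun k => (k <= r)%N) (fun e => (r < e)%N)
    (fun k => B k r.+1) (fun e => B r e)
    (fun k => sqrtr_ge0 _) (fun e => sqrtr_ge0 _) (fun k e => @leq_ltn_trans r k e).
  by move=> /(ler_wpM2l (ler0n _ 2)); rewrite !mulr_sumr; under eq_bigr do rewrite mulr_sumr.
rewrite -mulr_sumr -mulr_sumr big_split /=.
have -> : 2 * pi * #|'S_n|%:R = 2 * (pi / 2 * (#|'S_n|%:R + #|'S_n|%:R)) :> R by field.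
rewrite ler_wpM2l // ler_wpM2l ?divr_ge0 ?pi_ge0 //.
(* In each double sum the pairs of ranks, [(k, r + 1)] or [(r, e)], are distinct and increasing, so
   each input contributes at most its squared norm 1. *)
apply: lerD.
  rewrite (pair_big_dep xpredT (fun r k : 'I_n => (k <= r)%N) (fun r k : 'I_n => B k r.+1 ^+ 2)) /=.
  under eq_bigr do rewrite sqr_sqrtr //.
  rewrite exchange_big /= -sum1_card natr_sum; apply: ler_sum => s _.
  rewrite mulr1n -(psi1 s).
  apply: (sum_query_mass_le (a := fun p : 'I_n * 'I_n => p.2 : nat) (b := fun p => p.1.+1)) => //.
  by move=> [a b] [c d] /= _ _ h1 [h2]; congr (_, _); exact: ord_inj.
rewrite (pair_big_dep xpredT (fun r k : 'I_n => (r < k)%N) (fun r k : 'I_n => B r k ^+ 2)) /=.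
under eq_bigr do rewrite sqr_sqrtr //.
rewrite exchange_big /= -sum1_card natr_sum; apply: ler_sum => s _.
rewrite mulr1n -(psi1 s).
apply: (sum_query_mass_le (a := fun p : 'I_n * 'I_n => p.1 : nat) (b := fun p => p.2 : nat)) => //.
by move=> [a b] [c d] /= _ _ h1 h2; congr (_, _); exact: ord_inj.
Qed.
End Weight.

Lemma harmonicE (R : numFieldType) (m : nat) :
  \sum_(k < m) (m - k)%:R^-1 = harmonic R m.
Proof.
rewrite /harmonic big_add1 big_mkord (reindex_inj rev_ord_inj).
by apply: eq_bigr => k _ /=; congr (_%:R^-1); move: (ltn_ord k); lia.
Qed.

Lemma harmonicS (R : numFieldType) (m : nat) :
  harmonic R m.+1 = harmonic R m + m.+1%:R^-1.
Proof. by rewrite /harmonic big_nat_recr. Qed.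

(** Grouping by [e] gives [H_0 + ... + H_(n-1)], which is evaluated by induction. *)
Lemma sum_inv_diff (R : numFieldType) (n : nat) : (0 < n)%N ->
  \sum_(k < n) \sum_(e < n | (k < e)%N) (e - k)%:R^-1
  = n%:R * harmonic R n.-1 - n%:R + 1.
Proof.
move=> n0; rewrite (exchange_big_dep xpredT) //=.
transitivity (\sum_(e < n) harmonic R e).
  apply: eq_bigr => e _; rewrite -harmonicE.
  by rewrite (big_ord_widen n (fun k => (e - k)%:R^-1)) // ltnW.
case: n n0 => // n _ /=; elim: n => [|n IHn].
  by rewrite big_ord1 /harmonic big_geq // mulr0 add0r addNr.
rewrite big_ord_recr IHn /= harmonicS.
rewrite -[n.+2%:R]natr1; field.
by rewrite addrC natr1 pnatr_eq0.
Qed.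

(** * The lower bound *)

Lemma sqnorm_zero_state (R : rcfType) (n w : nat) : (0 < n)%N -> sqnorm (zero_state R n w) = 1.
Proof.
move=> n0; pose o := Ordinal n0.
pose x0 : basis_label n w := (o, o, false, [tuple of nseq w false]).
rewrite sqnorm_amp (bigD1 x0) //= big1 ?addr0 => [|[[[i j] b] c] xx0].
  by rewrite sqr_cabs /amp mxE enum_rankK /= eqxx expr1n expr0n addr0.
rewrite sqr_cabs /amp !mxE enum_rankK.
case: (boolP [&& _, _, _ & _]) => [/and4P[/eqP i0 /eqP j0 /negbTE b0 /eqP c0]|_]; last by rewrite /= expr0n addr0.
by case/eqP: xx0; rewrite /x0 b0; congr (_, _, _, _); apply: val_inj.
Qed.

Lemma sum_perm_const (R : nzRingType) (n : nat) (x : R) : \sum_(s : 'S_n) x = #|'S_n|%:R * x.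
Proof. by rewrite sumr_const mulr_natl. Qed.

Section Runs.
Variables (R : realType) (n w T : nat) (U : nat -> 'M[R[i]]_(hdim n w)).
Hypothesis n_gt0 : (0 < n)%N.
Hypothesis unitaryU : forall k, (k <= T)%N -> unitary (U k).

Lemma sqnorm_run s k : (k <= T)%N -> sqnorm (run U s k) = 1.
Proof.
elim: k => [|k IHk] kT /=; rewrite sqnorm_unitary ?sqnorm_zero_state //; try exact: unitaryU.
by rewrite sqnorm_oracle IHk // ltnW.
Qed.

Definition weight_at k := weight (fun s => run U s k).

(** The unitary after the query preserves inner products, so only the query itself can change the
    weight. *)
Lemma weight_at_step k : (k < T)%N -> weight_at k - weight_at k.+1 <= 2 * pi * #|'S_n|%:R.
Proof.
move=> kT; have -> : weight_at k.+1 = weight (fun s => oracle R w s *m run U s k).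
  apply: eq_bigr => s _; apply: eq_bigr => i _; apply: eq_bigr => j _ /=.
  by rewrite reip_unitary //; exact: unitaryU.
by apply: weight_step_le => s; rewrite sqnorm_run // ltnW.
Qed.

Lemma weight_at_loss k : (k <= T)%N -> weight_at 0 - weight_at k <= k%:R * (2 * pi * #|'S_n|%:R).
Proof.
elim: k => [|k IHk] kT; first by rewrite subrr mul0r.
have := weight_at_step kT; have := IHk (ltnW kT).
by rewrite -[k.+1%:R]natr1 mulrDl mul1r; lra.
Qed.

Definition total_weight : R := n%:R * harmonic R n.-1 - n%:R + 1.

Lemma weight_le (psi : 'S_n -> 'cV[R[i]]_(hdim n w)) (c : R) :
  (forall s (k e : 'I_n), (k < e)%N -> reip (psi s) (psi (s * cyc k e)%g) <= c) ->
  weight psi <= #|'S_n|%:R * (c * total_weight).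
Proof.
move=> psi_le; rewrite -sum_perm_const; apply: ler_sum => s _.
rewrite /total_weight -sum_inv_diff // mulr_sumr; apply: ler_sum => k _.
rewrite mulr_sumr; apply: ler_sum => e ke.
by rewrite mulrC ler_wpM2r ?invr_ge0 // psi_le.
Qed.

(** Before any query the state is the same unit vector for all inputs, so every inner product is
    1. *)
Lemma weight_at0 : weight_at 0 = #|'S_n|%:R * total_weight.
Proof.
rewrite -sum_perm_const; apply: eq_bigr => s _.
rewrite /total_weight -sum_inv_diff //; apply: eq_bigr => k _; apply: eq_bigr => e _ /=.
by rewrite reip_sqnorm sqnorm_unitary ?sqnorm_zero_state ?mulr1 //; exact: unitaryU.
Qed.
End Runs.

Theorem mainTheorem1 (R : realType) (n w T : nat) (eps : R)
  (U : nat -> 'M[R[i]]_(hdim n w)) :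
  (2 <= n)%N -> 0 <= eps -> eps < 2^-1 ->
  @sorts_with_error R n w T U eps ->
  (1 - 2 * Num.sqrt (eps * (1 - eps))) / (2 * pi) *
    (n%:R * harmonic R n.-1 - n%:R + 1) <= T%:R.
Proof.
move=> n2 eps0 eps_lt [unitaryU [E [mE correct]]].
have n0 : (0 < n)%N by exact: ltnW.
have M0 : (0 : R) < #|'S_n|%:R by rewrite ltr0n; apply/card_gt0P; exists 1%g.
set c := 2 * Num.sqrt (eps * (1 - eps)).
(* Paired inputs are distinct because the cycle is nontrivial, so the measurement must tell their
   final states apart. *)
have final : weight_at U T <= #|'S_n|%:R * (c * total_weight R n).
  apply: weight_le => // s k e ke.
  apply: (distinguishable_reip_le mE (s := s) (t := (s * cyc k e)%g)) => //.
  - by rewrite -[X in X == _]mulg1 (inj_eq (mulgI s)) eq_sym cyc_neq1.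
  - exact: (sqnorm_run n0 unitaryU).
  - exact: (sqnorm_run n0 unitaryU).
have := weight_at_loss n0 unitaryU (leqnn T).
rewrite (weight_at0 n0 unitaryU) => loss.
(* Clear the denominator and scale by the number of inputs: the claim becomes initial minus final
   weight against [T] times the loss per query. *)
rewrite mulrAC ler_pdivrMr ?mulr_gt0 ?pi_gt0 // -(ler_pM2l M0) -/(total_weight R n).
have -> : #|'S_n|%:R * ((1 - c) * total_weight R n)
          = #|'S_n|%:R * total_weight R n - #|'S_n|%:R * (c * total_weight R n) by ring.
have -> : #|'S_n|%:R * (T%:R * (2 * pi)) = T%:R * (2 * pi * #|'S_n|%:R) :> R by ring.
by apply: le_trans loss; rewrite lerD2l lerN2.
Qed.
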